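(* Let $\varphi$ be a $C^1$-process on $\mathbb{I}$ with $\varphi(\cdot,t_-,0)=0$, let $\Phi\in\mathcal{LP}(\mathbb{I},\mathbb{R}^n)$ be the linearization of $\varphi$ along $\varphi(\cdot,t_-,0)=0$, and suppose that the function $m$ is continuous at $0$. Let $Q$ be a linear projection on $\mathbb{R}^n$ such that $\operatorname{im}Q\subseteq V^{\mathrm s}(\Phi)$ and $\ker Q\subseteq V^{\mathrm u}(\Phi)$. Then there exist neighborhoods $U$ and $V$ of the origin such that $\operatorname{im}Q\cap U\subseteq W^{\mathrm s}_0$ and $\ker Q\cap V\subseteq W^{\mathrm u}_0$. Furthermore, for any $t\in\mathbb{I}$, $$T_0\,\varphi(t,t_-,[\operatorname{im}Q])=\Phi(t,t_-)[\operatorname{im}Q]\quad\text{and}\quad T_0\,\varphi(t,t_-,[\ker Q])=\Phi(t,t_-)[\ker Q],$$ where $\varphi(t,t_-,[M])$ denotes the image of the set $M$ under $\varphi(t,t_-,\cdot)$ and $T_0$ the tangent space at $0$. (Consequently $\varphi([\mathbb{I}],t_-,[\operatorname{im}Q\cap U])$ and $\varphi([\mathbb{I}],t_-,[\ker Q\cap V])$ are called finite-time local stable and unstable manifolds, respectively.)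
   Context: Let $n\ge 1$, let $|\cdot|$ be an arbitrary fixed norm on $\mathbb{R}^n$ with unit sphere $\mathcal{S}$, closed balls $B[0,\delta]$ and induced operator norm $\|\cdot\|$. Let $\mathbb{I}\subset\mathbb{R}$ be compact (not necessarily an interval), $t_-=\min\mathbb{I}<t_+=\max\mathbb{I}$. Put $\mathbb{I}^2_{\neq}=\{(t,s)\in\mathbb{I}\times\mathbb{I}: t\neq s\}$ with closure $\overline{\mathbb{I}^2_{\neq}}$ in $\mathbb{R}^2$. A process on $\mathbb{I}$ is a continuous map $\varphi:\mathbb{I}\times\mathbb{I}\times\mathbb{R}^n\to\mathbb{R}^n$, $(t,s,x)\mapsto\varphi(t,s,x)$, Lipschitz continuous in the first argument, with $\varphi(t,t,\cdot)=\mathrm{id}$ and $\varphi(t,s,\cdot)\circ\varphi(s,r,\cdot)=\varphi(t,r,\cdot)$ for all $t,s,r\in\mathbb{I}$. It is a $C^k$-process ($k\ge1$) if $\varphi(t,s,\cdot)\in C^k(\mathbb{R}^n,\mathbb{R}^n)$ for all $t,s$ and the space derivative $t\mapsto\partial_x\varphi(t,s,x)$ is Lipschitz continuous for all $s,x$. A linear process is a process $\Phi(t,s,x)=\Phi(t,s)x$ with $\Phi(t,s)\in GL(n,\mathbb{R})$ and $t\mapsto\Phi(t,s)$ Lipschitz continuous in operator norm. For continuous $f:\mathbb{I}\to(0,\infty)$ let $\Delta(f)(t,s)=\frac{\ln f(t)-\ln f(s)}{t-s}$, $(t,s)\in\mathbb{I}^2_{\neq}$. Standing assumption: $\mathcal{LP}(\mathbb{I},\mathbb{R}^n)$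 is the set of linear processes $\Phi$ for which $(x,t,s)\mapsto\Delta(|\Phi(\cdot,t_-)x|)(t,s)$ extends continuously from $\mathcal{S}\times\mathbb{I}^2_{\neq}$ to $\mathcal{S}\times\overline{\mathbb{I}^2_{\neq}}$ (same symbol for the extension). The linearization of $\varphi$ along $\varphi(\cdot,t_-,x)$ is $\Phi(t,s)=\partial_x\varphi(t,s,\varphi(s,t_-,x))$; along the zero trajectory, $\Phi(t,s)=\partial_x\varphi(t,s,0)$. $\mathrm{Gr}(1,\mathbb{R}^n)$ is the set of one-dimensional subspaces. For $X\in\mathrm{Gr}(1,\mathbb{R}^n)$, $\underline{\lambda}(X,\Phi)$ and $\overline{\lambda}(X,\Phi)$ are the minimum and maximum of $\Delta(|\Phi(\cdot,t_-)x|)(t,s)$ over $x\in X\cap\mathcal{S}$, $(t,s)\in\overline{\mathbb{I}^2_{\neq}}$. Stable and unstable cones: $V^{\mathrm s}(\Phi)=\bigcup\{X\in\mathrm{Gr}(1,\mathbb{R}^n):\overline{\lambda}(X,\Phi)<0\}$, $V^{\mathrm u}(\Phi)=\bigcup\{X\in\mathrm{Gr}(1,\mathbb{R}^n):\underline{\lambda}(X,\Phi)>0\}$. Cones and subspaces are identified with the sets of one-dimensional subspaces they contain, so for a subspace $M$, $M\subseteq V^{\mathrm s}(\Phi)$ means that every one-dimensional subspace of $M$ is contained in $V^{\mathrm s}(\Phi)$ (vacuous for $M=\{0\}$); likewise for $V^{\mathrm u}(\Phi)$. For $x\neq0$ and a process $\psi$ with $\psi(\cdot,t_-,0)=0$ put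 $\underline{\mu}(x,\psi)=\inf_{(t,s)\in\mathbb{I}^2_{\neq}}\Delta(|\psi(\cdot,t_-,x)|)(t,s)$ and $\overline{\mu}(x,\psi)=\sup_{(t,s)\in\mathbb{I}^2_{\neq}}\Delta(|\psi(\cdot,t_-,x)|)(t,s)$. Define $m(0)=0$ and, for $r>0$, $$m(r)=\sup_{x\in B[0,r]\setminus\{0\}}\max\{|\underline{\mu}(x,\varphi)-\underline{\mu}(x,\Phi)|,|\overline{\mu}(x,\varphi)-\overline{\mu}(x,\Phi)|\}\in[0,\infty].$$ Domains of attraction and repulsion of the zero trajectory: $W^{\mathrm s}_0=\{x\neq0:\overline{\mu}(x,\varphi)<0\}\cup\{0\}$, $W^{\mathrm u}_0=\{x\neq0:\underline{\mu}(x,\varphi)>0\}\cup\{0\}$. *)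

(* Defs.v *)
From HB Require Import structures.
From mathcomp Require Import all_boot all_order all_algebra.
From mathcomp Require Import all_classical all_reals all_analysis.

Set Implicit Arguments.
Unset Strict Implicit.
Unset Printing Implicit Defensive.

Import Order.TTheory GRing.Theory Num.Theory.
Import numFieldNormedType.Exports.

Local Open Scope classical_set_scope.
Local Open Scope ring_scope.

(* R^n is the space of row vectors 'rV[R]_n, so a matrix A
   acts by x |-> x *m A, which is the convention of the library's [jacobian].
   Processes are total functions R -> R -> 'rV_n -> 'rV_n whose values matter
   only for time arguments in the time set I. *)

Definition is_norm (R : realType) (n : nat) (N : 'rV[R]_n -> R) : Prop :=
  [/\ forall x, N x = 0 -> x = 0,
      forall (a : R) x, N (a *: x) = `|a| * N x
    & forall x y, N (x + y) <= N x + N y].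

Definition unit_sphere (R : realType) (n : nat) (N : 'rV[R]_n -> R) :
  set 'rV[R]_n := [set x | N x = 1].

Definition closed_ball0 (R : realType) (n : nat) (N : 'rV[R]_n -> R) (r : R) :
  set 'rV[R]_n := [set x | N x <= r].

Definition opnorm (R : realType) (n : nat) (N : 'rV[R]_n -> R)
  (A : 'M[R]_n) : R := sup [set N (x *m A) | x in unit_sphere N].

Definition offdiag (R : realType) (I : set R) : set (R * R) :=
  [set p | [/\ I p.1, I p.2 & p.1 != p.2]].

Definition lipschitz_wrt (R : realType) (V : zmodType) (M : V -> R)
  (I : set R) (f : R -> V) : Prop :=
  exists L : R, forall t t', I t -> I t' -> M (f t - f t') <= L * `|t - t'|.

Definition is_process (R : realType) (n : nat) (N : 'rV[R]_n -> R)
  (I : set R) (phi : R -> R -> 'rV[R]_n -> 'rV[R]_n) : Prop :=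
  [/\ {within I `*` I `*` [set: 'rV[R]_n],
        continuous (fun p : R * R * 'rV[R]_n => phi p.1.1 p.1.2 p.2)},
      forall s x, I s -> lipschitz_wrt N I (fun t => phi t s x),
      forall t x, I t -> phi t t x = x
    & forall t s r x, I t -> I s -> I r ->
        phi t s (phi s r x) = phi t r x].

(* Topology and differentiability are those of the library (max norm), which
   agree with those of any norm on R^n. *)
Definition C1 (R : realType) (n : nat) (f : 'rV[R]_n -> 'rV[R]_n) : Prop :=
  (forall x, differentiable f x) /\ continuous (jacobian f).

Definition is_C1_process (R : realType) (n : nat) (N : 'rV[R]_n -> R)
  (I : set R) (phi : R -> R -> 'rV[R]_n -> 'rV[R]_n) : Prop :=
  [/\ is_process N I phi,
      forall t s, I t -> I s -> C1 (phi t s)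
    & forall s x, I s ->
        lipschitz_wrt (opnorm N) I (fun t => jacobian (phi t s) x)].

Definition process_of_mx (R : realType) (n : nat) (Phi : R -> R -> 'M[R]_n) :
  R -> R -> 'rV[R]_n -> 'rV[R]_n := fun t s x => x *m Phi t s.

Definition is_linear_process (R : realType) (n : nat) (N : 'rV[R]_n -> R)
  (I : set R) (Phi : R -> R -> 'M[R]_n) : Prop :=
  [/\ is_process N I (process_of_mx Phi),
      forall t s, I t -> I s -> Phi t s \in unitmx
    & forall s, I s -> lipschitz_wrt (opnorm N) I (fun t => Phi t s)].

(* The linearization along the trajectory phi(., tm, x). *)
Definition linearization (R : realType) (n : nat)
  (phi : R -> R -> 'rV[R]_n -> 'rV[R]_n) (tm : R) (x : 'rV[R]_n) :
  R -> R -> 'M[R]_n := fun t s => jacobian (phi t s) (phi s tm x).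

Definition Delta (R : realType) (f : R -> R) (p : R * R) : R :=
  (ln (f p.1) - ln (f p.2)) / (p.1 - p.2).

(* E extends (x, t, s) |-> Delta(|Phi(., tm) x|)(t, s) continuously from
   S x offdiag I to S x closure (offdiag I); it is unique on the latter set. *)
Definition is_Delta_extension (R : realType) (n : nat) (N : 'rV[R]_n -> R)
  (I : set R) (tm : R) (Phi : R -> R -> 'M[R]_n)
  (E : 'rV[R]_n * (R * R) -> R) : Prop :=
  {within unit_sphere N `*` closure (offdiag I), continuous E} /\
  (forall x p, unit_sphere N x -> offdiag I p ->
     E (x, p) = Delta (fun t => N (x *m Phi t tm)) p).

Definition LP (R : realType) (n : nat) (N : 'rV[R]_n -> R) (I : set R)
  (tm : R) : set (R -> R -> 'M[R]_n) :=
  [set Phi | is_linear_process N I Phi /\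
             exists E, is_Delta_extension N I tm Phi E].

Definition Delta_ext (R : realType) (n : nat) (N : 'rV[R]_n -> R) (I : set R)
  (tm : R) (Phi : R -> R -> 'M[R]_n) : 'rV[R]_n * (R * R) -> R :=
  xget (fun _ => 0) [set E | is_Delta_extension N I tm Phi E].

(* The value 0 is used when there is no maximum (resp. minimum); this does not
   happen in [lambda_max] and [lambda_min] for Phi in LP, by compactness. *)
Definition maximum (R : realType) (A : set R) : R :=
  xget 0 (A `&` ubound A).

Definition minimum (R : realType) (A : set R) : R :=
  xget 0 (A `&` lbound A).

Definition growth_values (R : realType) (n : nat) (N : 'rV[R]_n -> R)
  (I : set R) (tm : R) (Phi : R -> R -> 'M[R]_n) (X : {vspace 'rV[R]_n}) :
  set R :=
  [set Delta_ext N I tm Phi z |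
     z in ([set` X] `&` unit_sphere N) `*` closure (offdiag I)].

Definition lambda_min (R : realType) (n : nat) (N : 'rV[R]_n -> R)
  (I : set R) (tm : R) (X : {vspace 'rV[R]_n}) (Phi : R -> R -> 'M[R]_n) : R :=
  minimum (growth_values N I tm Phi X).

Definition lambda_max (R : realType) (n : nat) (N : 'rV[R]_n -> R)
  (I : set R) (tm : R) (X : {vspace 'rV[R]_n}) (Phi : R -> R -> 'M[R]_n) : R :=
  maximum (growth_values N I tm Phi X).

Definition Gr1 (R : realType) (n : nat) : set {vspace 'rV[R]_n} :=
  [set X | \dim X = 1%N].

Definition stable_cone (R : realType) (n : nat) (N : 'rV[R]_n -> R)
  (I : set R) (tm : R) (Phi : R -> R -> 'M[R]_n) : set 'rV[R]_n :=
  \bigcup_(X in [set X | Gr1 X /\ lambda_max N I tm X Phi < 0]) [set` X].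

Definition unstable_cone (R : realType) (n : nat) (N : 'rV[R]_n -> R)
  (I : set R) (tm : R) (Phi : R -> R -> 'M[R]_n) : set 'rV[R]_n :=
  \bigcup_(X in [set X | Gr1 X /\ 0 < lambda_min N I tm X Phi]) [set` X].

(* Inclusion of a subspace in a cone, both identified with the sets of
   one-dimensional subspaces they contain; vacuous for the zero subspace. *)
Definition sub_cone (R : realType) (n : nat) (M : {vspace 'rV[R]_n})
  (C : set 'rV[R]_n) : Prop :=
  forall X : {vspace 'rV[R]_n}, Gr1 X -> (X <= M)%VS -> [set` X] `<=` C.

Definition mu_values (R : realType) (n : nat) (N : 'rV[R]_n -> R)
  (I : set R) (tm : R) (x : 'rV[R]_n)
  (psi : R -> R -> 'rV[R]_n -> 'rV[R]_n) : set (\bar R) :=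
  [set (Delta (fun t => N (psi t tm x)) p)%:E | p in offdiag I].

Definition mu_min (R : realType) (n : nat) (N : 'rV[R]_n -> R)
  (I : set R) (tm : R) (x : 'rV[R]_n)
  (psi : R -> R -> 'rV[R]_n -> 'rV[R]_n) : \bar R :=
  ereal_inf (mu_values N I tm x psi).

Definition mu_max (R : realType) (n : nat) (N : 'rV[R]_n -> R)
  (I : set R) (tm : R) (x : 'rV[R]_n)
  (psi : R -> R -> 'rV[R]_n -> 'rV[R]_n) : \bar R :=
  ereal_sup (mu_values N I tm x psi).

(* The function m; only its values at r >= 0 are meaningful. *)
Definition mu_deviation (R : realType) (n : nat) (N : 'rV[R]_n -> R)
  (I : set R) (tm : R) (phi : R -> R -> 'rV[R]_n -> 'rV[R]_n)
  (Phi : R -> R -> 'M[R]_n) (r : R) : \bar R :=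
  if r == 0 then 0%E else
  ereal_sup
    [set maxe `|mu_min N I tm x phi - mu_min N I tm x (process_of_mx Phi)|%E
              `|mu_max N I tm x phi - mu_max N I tm x (process_of_mx Phi)|%E
    | x in closed_ball0 N r `\ (0 : 'rV[R]_n)].

Definition attraction_domain (R : realType) (n : nat) (N : 'rV[R]_n -> R)
  (I : set R) (tm : R) (phi : R -> R -> 'rV[R]_n -> 'rV[R]_n) :
  set 'rV[R]_n :=
  [set x | x != 0 /\ (mu_max N I tm x phi < 0)%E] `|` [set 0].

Definition repulsion_domain (R : realType) (n : nat) (N : 'rV[R]_n -> R)
  (I : set R) (tm : R) (phi : R -> R -> 'rV[R]_n -> 'rV[R]_n) :
  set 'rV[R]_n :=
  [set x | x != 0 /\ (0 < mu_min N I tm x phi)%E] `|` [set 0].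

(* Velocities at p of C^1 curves lying in M and passing through p: the tangent
   space at p whenever M is a C^1-submanifold. *)
Definition tangent_space (R : realType) (n : nat) (p : 'rV[R]_n)
  (M : set 'rV[R]_n) : set 'rV[R]_n :=
  [set v | exists (g : R -> 'rV[R]_n) (e : R),
     [/\ 0 < e,
         g 0 = p /\ {in `]- e, e[, forall u, M (g u)},
         {in `]- e, e[, forall u, derivable g u 1},
         {in `]- e, e[, continuous (derive1 g)}
       & derive1 g 0 = v]].

(* Main.v *)
Require Import Defs.
From HB Require Import structures.
From mathcomp Require Import all_boot all_order all_algebra.
From mathcomp Require Import all_classical all_reals all_analysis.

Import Order.TTheory GRing.Theory Num.Theory.
Import numFieldNormedType.Exports.

Local Open Scope classical_set_scope.
Local Open Scope ring_scope.

(** The two halves of the theorem are independent.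

    Domains of attraction and repulsion.  The unit sphere of the norm and the
    closure of the off-diagonal times are compact, and the growth rates of the
    linear process extend continuously to their product.  When every line of
    the image of [Q] lies in the stable cone, the maximal rate over the whole
    image is attained on one of its lines, hence is a negative constant [c]
    ([lambda_max_lt0]).  As rates are invariant under scaling of the initial
    value ([growth_values_Delta]), [mu_max] of the linear process is at most [c]
    at every nonzero point of the image ([stable_uniform_rate]).  Continuity of
    the deviation [m] at 0 says that the rates of [phi] at a point [x] differ
    from those of the linear process by less than [- c] as soon as [x] is close
    to 0 ([deviation_near0]), so [mu_max] of [phi] is still negative there.
    The kernel and the minimal rates are treated in the same way.

    Tangent spaces.  [phi t tm] is a C^1 map fixing 0 with differentiable
    inverse [phi tm t], and its derivative at 0 is [Phi t tm].  Such a map sends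
    a subspace to a set whose tangent space at 0 is the image of the subspace
    under the derivative ([tangent_space_diffeo_image]). *)

(** * Norms, linear maps and subspaces in finite dimension *)

Section FiniteDimension.
Context {R : realType}.

Lemma seminorm0 {V : lmodType R} {p : V -> R} :
  (forall a x, p (a *: x) = `|a| * p x) -> p 0 = 0.
Proof. by move=> pZ; rewrite -(scale0r 0) pZ normr0 mul0r. Qed.

Lemma seminorm_ge0 {V : lmodType R} {p : V -> R} x :
  (forall a x, p (a *: x) = `|a| * p x) ->
  (forall x y, p (x + y) <= p x + p y) -> 0 <= p x.
Proof.
move=> pZ pD; have := pD x (- 1 *: x).
by rewrite pZ normrN1 mul1r scaleN1r subrr (seminorm0 pZ) -mulr2n pmulrn_lge0.
Qed.

(** A seminorm is at most the sum, over the entries of the matrix, of the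
    absolute value of the entry times the seminorm of the corresponding
    elementary matrix.  This gives continuity both for the norm that measures
    growth and for linear maps, as [fun A => `|L A|] is a seminorm. *)
Lemma seminorm_bounded {m n : nat} {p : 'M[R]_(m, n) -> R} :
  (forall a A, p (a *: A) = `|a| * p A) ->
  (forall A B, p (A + B) <= p A + p B) ->
  exists2 C, 0 < C & forall A, p A <= C * `|A|.
Proof.
move=> pZ pD.
have p0 := seminorm0 pZ; have p_ge0 A := seminorm_ge0 A pZ pD.
exists (\sum_i \sum_j p (delta_mx i j) + 1) => [|A].
  by rewrite ltr_wpDl// sumr_ge0// => i _; rewrite sumr_ge0.
have p_sum (I : Type) (r : seq I) (F : I -> 'M[R]_(m, n)) :
    p (\sum_(i <- r) F i) <= \sum_(i <- r) p (F i).
  elim/big_ind2 : _ => //; first by rewrite p0.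
  by move=> B x D y Bx Dy; exact: le_trans (pD _ _) (lerD Bx Dy).
rewrite mulrDl ler_wpDr// {1}(matrix_sum_delta A) (le_trans (p_sum _ _ _))//.
rewrite mulr_suml; apply: ler_sum => i _; rewrite (le_trans (p_sum _ _ _))// mulr_suml.
apply: ler_sum => j _; rewrite pZ mulrC ler_wpM2l//.
by rewrite /Num.norm/= mx_normrE (le_bigmax _ (fun ij => `|A ij.1 ij.2|) (i, j)).
Qed.

Lemma is_norm0 {n : nat} {N : 'rV[R]_n -> R} : is_norm N -> N 0 = 0.
Proof. by case=> _ NZ _; exact: seminorm0. Qed.

Lemma is_norm_ge0 {n : nat} {N : 'rV[R]_n -> R} x : is_norm N -> 0 <= N x.
Proof. by case=> _ NZ ND; exact: seminorm_ge0. Qed.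

Lemma is_norm_gt0 {n : nat} {N : 'rV[R]_n -> R} x :
  is_norm N -> x != 0 -> 0 < N x.
Proof.
move=> hN x0; rewrite lt_def is_norm_ge0// andbT.
by apply: contra_neq x0; case: hN => + _ _; exact.
Qed.

Lemma is_norm_continuous {n : nat} {N : 'rV[R]_n -> R} :
  is_norm N -> continuous N.
Proof.
case=> _ NZ ND x; have [C C0 NC] := seminorm_bounded NZ ND.
have NB y z : N y - N z <= C * `|y - z|.
  by rewrite (le_trans _ (NC _))// lerBlDr (le_trans _ (ND _ _))// subrK.
apply/(@cvgrPdist_lt _ _ _ (nbhs x)) => e e0; near=> y.
apply: (@le_lt_trans _ _ (C * `|x - y|)).
  by rewrite ler_norml NB andbT lerNl opprB distrC NB.
rewrite -ltr_pdivlMl// mulrC; near: y.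
by apply: cvgr_dist_lt => //; rewrite divr_gt0.
Unshelve. all: by end_near. Qed.

Lemma unit_sphere_neq0 {n : nat} {N : 'rV[R]_n -> R} w :
  is_norm N -> unit_sphere N w -> w != 0.
Proof.
by move=> hN; apply: contra_eq_neq => ->; rewrite (is_norm0 hN) eq_sym oner_neq0.
Qed.

Lemma linear_mx_continuous {m n : nat} {V : normedModType R}
  (L : {linear 'M[R]_(m, n) -> V}) : continuous L.
Proof.
have [C _ LC] : exists2 C, 0 < C & forall A, `|L A| <= C * `|A|.
  apply: (@seminorm_bounded m n (fun A => `|L A|)).
    by move=> a A; rewrite linearZ normrZ.
  by move=> A B; rewrite linearD ler_normD.
apply/linear_bounded_continuous/linear_boundedP.
exists C; split; first exact: num_real.
by move=> r /ltW Cr A; rewrite (le_trans (LC A))// ler_wpM2r.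
Qed.

Lemma vspace_closed {n : nat} (M : {vspace 'rV[R]_n}) :
  closed [set` M].
Proof.
have -> : [set` M] = (fun x => x - projv M x) @^-1` [set 0].
  apply/seteqP; split => x /=.
    by move=> xM; rewrite projv_id// subrr.
  by move=> /eqP; rewrite subr_eq0 => /eqP ->; exact: memv_proj.
apply: (continuous_closedP _).1; last first.
  exact/accessible_closed_set1/hausdorff_accessible/norm_hausdorff.
move=> x; apply: continuousB; first exact: cvg_id.
exact: linear_mx_continuous.
Qed.

(** By Heine-Borel only boundedness in the max norm is at stake.  The minimum
    [c] of [N] on the max-norm sphere is positive, so [c * `|x| <= N x] for all
    [x] by homogeneity: half of the equivalence of norms. *)
Lemma unit_sphere_compact {n : nat} {N : 'rV[R]_n -> R} :
  is_norm N -> compact (unit_sphere N).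
Proof.
move=> hN; have cN := is_norm_continuous hN; have [N0 NZ ND] := hN.
apply: bounded_closed_compact; last first.
  exact: ((continuous_closedP N).1 cN [set 1] (@closed_eq R 1)).
have sphere_compact : compact [set x : 'rV[R]_n | `|x| = 1].
  apply: bounded_closed_compact.
    exists 1; split; first exact: num_real.
    by move=> r /ltW r1 x /= ->.
  exact: ((continuous_closedP _).1 (@norm_continuous R 'rV[R]_n) [set 1] (@closed_eq R 1)).
have scaled_unit (x : 'rV[R]_n) : x != 0 -> `| (`|x|^-1 *: x) | = 1.
  by move=> x0; rewrite normrZ normfV normr_id mulVf// normr_eq0.
have [c c0 c_le] : exists2 c, 0 < c & forall x, `|x| = 1 -> c <= N x.
  (* The max-norm sphere is empty when n = 0, and then any c works. *)
  have [E0|E0] := pselect ([set x : 'rV[R]_n | `|x| = 1] !=set0); last first.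
    by exists 1 => // x x1; exfalso; apply: E0; exists x.
  have [x /set_mem /= x1 xmin] :=
    compact_EVT_min E0 sphere_compact (continuous_subspaceT cN).
  exists (N x); last by move=> y y1; apply: xmin; exact/mem_set.
  by apply: (is_norm_gt0 _ hN); rewrite -normr_gt0 x1.
exists c^-1; split; first exact: num_real.
move=> r /ltW cr x /= Nx1; apply: le_trans cr.
have x0 : x != 0 by exact: (unit_sphere_neq0 x hN Nx1).
rewrite -[leLHS]invrK lef_pV2 ?posrE ?invr_gt0 ?normr_gt0//.
by have := c_le _ (scaled_unit x x0); rewrite NZ Nx1 mulr1 normfV normr_id.
Qed.

End FiniteDimension.

(** * Tangent spaces of images of subspaces *)

Section TangentSpace.
Context {R : realType} {n : nat}.
Implicit Types (f finv : 'rV[R]_n -> 'rV[R]_n) (M : {vspace 'rV[R]_n}).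

Lemma derive1_comp_differentiable {f} {g : R -> 'rV[R]_n} {u} :
  differentiable f (g u) -> differentiable g u ->
  derive1 (f \o g) u = derive1 g u *m jacobian f (g u).
Proof.
move=> df dg; rewrite !derive1E' //; last exact: differentiable_comp.
have := congr1 (fun F : R -> 'rV[R]_n => F 1) (diff_comp dg df).
by rewrite /jacobian mul_rV_lin1.
Qed.

(** The difference quotients of the curve lie in [M], which is closed. *)
Lemma derive1_mem_vspace (h : R -> 'rV[R]_n) u M :
  derivable h u 1 -> (\forall s \near u, h s \in M) -> derive1 h u \in M.
Proof.
move=> dh hM; rewrite derive1E.
suff : [set` M] ('D_1 h u) by [].
apply: (@closed_cvg _ _ 0^' _ _ _ (vspace_closed M) _ _ dh).
have hM0 := hM; rewrite (near_shift 0) subr0 in hM0.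
apply: nbhs_dnbhs; apply: filterS hM0 => t /= htM.
rewrite [t *: 1]mulr1.
by rewrite memvZ// memvB//; exact: nbhs_singleton hM.
Qed.

(** Since [finv] carries a curve in [f @` M] back to a curve in [M], every
    velocity at 0 is the image under the derivative of [f] of a velocity of a
    curve in [M], hence of an element of [M].  Conversely, [w] in [M] is the
    velocity of the line through 0 and [w], whose image under [f] is a C^1
    curve. *)
Lemma tangent_space_diffeo_image f finv M :
  C1 f -> differentiable finv 0 -> cancel f finv -> cancel finv f ->
  f 0 = 0 ->
  tangent_space 0 (f @` [set` M]) = (mulmx^~ (jacobian f 0)) @` [set` M].
Proof.
move=> [df cf] dfinv fK finvK f0; apply/seteqP; split => v.
  case=> g [e [e0 [g0 gM] dg _ <-]].
  have dg0 : differentiable g 0.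
    by apply/derivable1_diffP/dg; rewrite in_itv/= oppr_lt0 e0.
  have hE : g = f \o (finv \o g) by apply/funext => u /=; rewrite finvK.
  have finv0 : finv (g 0) = 0 by rewrite g0 -{1}f0 fK.
  have dh : differentiable (finv \o g) 0.
    by apply: differentiable_comp => //; rewrite g0.
  exists (derive1 (finv \o g) 0).
    apply: derive1_mem_vspace; first exact/derivable1_diffP.
    have int0 : \forall s \near (0 : R), s \in `]- e, e[.
      by apply: near_in_itvoo; rewrite in_itv/= oppr_lt0 e0.
    by apply: filterS int0 => s /gM[x xM fx] /=; rewrite -fx fK.
  by rewrite [in RHS]hE (derive1_comp_differentiable (df _) dh) [(finv \o g) 0]finv0.
move=> [w wM <-{v}].
have dline u : differentiable (fun s : R => s *: w) u by [].
have line1 u : derive1 (fun s : R => s *: w) u = w.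
  by rewrite derive1E'// diff_val scale1r.
exists (f \o (fun u => u *: w)), 1; split => //.
- split; first by rewrite /= scale0r.
  by move=> u _; exists (u *: w) => //=; exact: memvZ.
- by move=> u _; apply/derivable1_diffP; exact: differentiable_comp.
- move=> u _.
  have -> : derive1 (f \o (fun s : R => s *: w)) =
      mulmx w \o (jacobian f \o (fun s => s *: w)).
    by apply/funext => s; rewrite (derive1_comp_differentiable (df _) (dline s)) line1.
  apply: continuous_comp; last exact: linear_mx_continuous.
  apply: continuous_comp; last exact: cf.
  exact: differentiable_continuous.
- by rewrite (derive1_comp_differentiable (df _) (dline 0)) line1 scale0r.
Qed.

End TangentSpace.

(** * Uniform exponential rates of the linear process *)

Lemma maximumP {R : realType} {A : set R} :
  A !=set0 -> compact A -> (A `&` ubound A) (maximum A).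
Proof.
move=> A0 cA; have cid : {within A, continuous (fun x : R => x)}.
  by apply: continuous_subspaceT => x; exact: cvg_id.
have [a /set_mem Aa amax] := compact_EVT_max A0 cA cid.
by apply: xgetPex; exists a; split => // b Ab; apply: amax; exact/mem_set.
Qed.

Lemma minimumP {R : realType} {A : set R} :
  A !=set0 -> compact A -> (A `&` lbound A) (minimum A).
Proof.
move=> A0 cA; have cid : {within A, continuous (fun x : R => x)}.
  by apply: continuous_subspaceT => x; exact: cvg_id.
have [a /set_mem Aa amin] := compact_EVT_min A0 cA cid.
by apply: xgetPex; exists a; split => // b Ab; apply: amin; exact/mem_set.
Qed.

(** A one-dimensional subspace containing [w != 0] is the line of [w], so
    inclusion of subspaces in a cone can be tested vector by vector. *)
Lemma sub_cone_line {R : realType} {n : nat} {M : {vspace 'rV[R]_n}}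
    {P : set {vspace 'rV[R]_n}} {w} :
  sub_cone M (\bigcup_(X in P) [set` X]) -> w \in M -> w != 0 ->
  exists2 X, P X & w \in X.
Proof.
move=> MC wM w0; have Gr_w : @Gr1 R n <[w]>%VS by rewrite /Gr1/= dim_vline w0.
have wM' : (<[w]> <= M)%VS by rewrite -memvE.
by have [X PX wX] := MC _ Gr_w wM' w (memv_line w); exists X.
Qed.

Section ExponentialRates.
Context {R : realType} {n : nat} {N : 'rV[R]_n -> R} {I : set R} {tm : R}.
Context (hN : is_norm N) (cI : compact I) (Itm : I tm).

Lemma closure_offdiag_compact : compact (closure (offdiag I)).
Proof.
have cII : compact (I `*` I) by exact: compact_setX.
have closedII : closed (I `*` I).
  by apply: compact_closed cII; exact: norm_hausdorff.
apply: subclosed_compact cII _; first exact: closed_closure.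
by rewrite [X in _ `<=` X](closure_id _).1//; apply: closureS => -[t s] [].
Qed.

Context {Phi : R -> R -> 'M[R]_n}.
Context (hPhi : LP N I tm Phi).

Lemma growth_values_compact (M : {vspace 'rV[R]_n}) :
  compact (growth_values N I tm Phi M).
Proof.
have [cE _] : is_Delta_extension N I tm Phi (Delta_ext N I tm Phi).
  by apply: xgetPex; case: hPhi.
apply: continuous_compact.
  by apply: continuous_subspaceW cE => -[x p] [[_ x1] pD].
apply: compact_setX; last exact: closure_offdiag_compact.
by rewrite setIC; apply: compact_closedI (unit_sphere_compact hN) (vspace_closed M).
Qed.

(** The rate of a solution depends only on the line of its initial value:
    rescaling [x] to the unit sphere shifts [ln (N (x *m Phi t tm))] by a
    constant. *)
Lemma growth_values_Delta {M : {vspace 'rV[R]_n}} {x p} :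
  x \in M -> x != 0 -> offdiag I p ->
  growth_values N I tm Phi M (Delta (fun t => N (x *m Phi t tm)) p).
Proof.
move=> xM x0 pI.
have [_ E_Delta] : is_Delta_extension N I tm Phi (Delta_ext N I tm Phi).
  by apply: xgetPex; case: hPhi.
have [_ NZ _] := hN; have Nx0 := is_norm_gt0 x hN x0.
have unit1 : N ((N x)^-1 *: x) = 1.
  by rewrite NZ ger0_norm ?invr_ge0 ?ltW// mulVf// gt_eqF.
exists ((N x)^-1 *: x, p).
  split; last exact: subset_closure.
  by split => //=; exact: memvZ.
rewrite E_Delta//; have [[_ Phi_unit _] _] := hPhi.
have lnE t : I t ->
    ln (N ((N x)^-1 *: x *m Phi t tm)) = ln (N x)^-1 + ln (N (x *m Phi t tm)).
  move=> It; rewrite -scalemxAl NZ ger0_norm ?invr_ge0 ?ltW//.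
  rewrite lnM// posrE ?invr_gt0//; apply: (is_norm_gt0 _ hN).
  apply: contra_neq x0 => xPhi0.
  by rewrite -(mulmxK (Phi_unit t tm It Itm) x) xPhi0 mul0mx.
by case: p pI => t s [/= It Is _]; rewrite /Delta/= !lnE// opprD addrACA subrr add0r.
Qed.

(** Here compactness makes the rates uniform: each line of [M] only has a
    negative rate of its own, but the maximum over [M] is attained, and it is
    attained on one of these lines. *)
Lemma lambda_max_lt0 {M : {vspace 'rV[R]_n}} :
  sub_cone M (stable_cone N I tm Phi) ->
  growth_values N I tm Phi M !=set0 -> lambda_max N I tm M Phi < 0.
Proof.
move=> Mstable M0; rewrite /lambda_max.
have [[[w p] [[/= wM w1] pD] <-] _] := maximumP M0 (growth_values_compact M).
have [X [_ X_lt0] wX] := sub_cone_line Mstable wM (unit_sphere_neq0 w hN w1).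
apply: le_lt_trans X_lt0.
have Xwp : growth_values N I tm Phi X (Delta_ext N I tm Phi (w, p)).
  by exists (w, p).
have [_ ub] := maximumP (ex_intro _ _ Xwp) (growth_values_compact X).
exact: ub.
Qed.

Lemma lambda_min_gt0 {M : {vspace 'rV[R]_n}} :
  sub_cone M (unstable_cone N I tm Phi) ->
  growth_values N I tm Phi M !=set0 -> 0 < lambda_min N I tm M Phi.
Proof.
move=> Munstable M0; rewrite /lambda_min.
have [[[w p] [[/= wM w1] pD] <-] _] := minimumP M0 (growth_values_compact M).
have [X [_ X_gt0] wX] := sub_cone_line Munstable wM (unit_sphere_neq0 w hN w1).
apply: lt_le_trans X_gt0 _.
have Xwp : growth_values N I tm Phi X (Delta_ext N I tm Phi (w, p)).
  by exists (w, p).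
have [_ lb] := minimumP (ex_intro _ _ Xwp) (growth_values_compact X).
exact: lb.
Qed.

Lemma stable_uniform_rate {M : {vspace 'rV[R]_n}} :
  sub_cone M (stable_cone N I tm Phi) ->
  exists2 c : R, c < 0 & forall x, x \in M -> x != 0 ->
    (mu_max N I tm x (process_of_mx Phi) <= c%:E)%E.
Proof.
move=> Mstable.
have [M0|M0] := pselect (growth_values N I tm Phi M !=set0).
  exists (lambda_max N I tm M Phi); first exact: lambda_max_lt0.
  move=> x xM x0; apply: ge_ereal_sup => _ [p pI <-]; rewrite lee_fin.
  have [_ ub] := maximumP M0 (growth_values_compact M).
  by apply: ub; exact: growth_values_Delta.
(* Without growth values, a nonzero [x] in [M] has no rates at all, and any
   negative constant bounds the supremum of the empty set. *)
exists (-1); first by rewrite ltrN10.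
move=> x xM x0; apply: ge_ereal_sup => _ [p pI <-]; exfalso; apply: M0.
exact: ex_intro (growth_values_Delta xM x0 pI).
Qed.

Lemma unstable_uniform_rate {M : {vspace 'rV[R]_n}} :
  sub_cone M (unstable_cone N I tm Phi) ->
  exists2 c : R, 0 < c & forall x, x \in M -> x != 0 ->
    (c%:E <= mu_min N I tm x (process_of_mx Phi))%E.
Proof.
move=> Munstable.
have [M0|M0] := pselect (growth_values N I tm Phi M !=set0).
  exists (lambda_min N I tm M Phi); first exact: lambda_min_gt0.
  move=> x xM x0; apply: le_ereal_inf_tmp => _ [p pI <-]; rewrite lee_fin.
  have [_ lb] := minimumP M0 (growth_values_compact M).
  by apply: lb; exact: growth_values_Delta.
exists 1 => // x xM x0; apply: le_ereal_inf_tmp => _ [p pI <-]; exfalso; apply: M0.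
exact: ex_intro (growth_values_Delta xM x0 pI).
Qed.

End ExponentialRates.

(** * From the linear to the nonlinear process *)

Section Deviation.
Context {R : realType} {n : nat} {N : 'rV[R]_n -> R} {I : set R} {tm : R}
  {phi : R -> R -> 'rV[R]_n -> 'rV[R]_n} {Phi : R -> R -> 'M[R]_n}.
Context (hN : is_norm N)
  (hm : mu_deviation N I tm phi Phi r
    @[r --> within [set r : R | 0 <= r] (nbhs (0 : R))] -->
    mu_deviation N I tm phi Phi 0).

(** Each [x] is tested against the ball of its own radius [N x], which tends to
    0 with [x]. *)
Lemma deviation_near0 (e : R) : 0 < e ->
  \forall x \near (0 : 'rV[R]_n), x != 0 ->
    (`|mu_min N I tm x phi - mu_min N I tm x (process_of_mx Phi)| < e%:E)%E /\
    (`|mu_max N I tm x phi - mu_max N I tm x (process_of_mx Phi)| < e%:E)%E.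
Proof.
move=> e0.
have m_lt : \forall r \near (0 : R), 0 <= r ->
    (mu_deviation N I tm phi Phi r < e%:E)%E.
  have m0_lt : nbhs (mu_deviation N I tm phi Phi 0) [set y | (y < e%:E)%E].
    rewrite /mu_deviation eqxx; apply: open_nbhs_nbhs.
    by split; [exact: open_ereal_lt_ereal | rewrite /= lte_fin].
  exact: (hm _ m0_lt).
have N_cvg : N x @[x --> (0 : 'rV[R]_n)] --> (0 : R).
  by rewrite -[X in _ --> X](is_norm0 hN); exact: is_norm_continuous.
have near_m := N_cvg _ m_lt.
near=> x => x0.
have mx_lt : (mu_deviation N I tm phi Phi (N x) < e%:E)%E.
  by have := is_norm_ge0 x hN; near: x.
rewrite /mu_deviation gt_eqF ?is_norm_gt0// in mx_lt.
apply/andP; rewrite -gt_max; apply: le_lt_trans mx_lt.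
apply: ereal_sup_ubound; exists x => //.
by split => /=; [exact: lexx | exact/eqP].
Unshelve. all: by end_near. Qed.

End Deviation.

(** The hypothesis on [`|a - b|] forces both numbers to be finite, as a
    difference with an infinite term has infinite absolute value. *)
Lemma lt0_of_deviation {R : realType} {a b : \bar R} {c : R} :
  (b <= c%:E)%E -> (`|a - b| < (- c)%:E)%E -> (a < 0)%E.
Proof.
move: a b => [a| |] [b| |] //=; rewrite ?lee_fin ?lte_fin//.
move=> bc; rewrite ltr_norml => /andP[_]; rewrite ltrBlDr => /lt_le_trans; apply.
by rewrite addrC subr_le0.
Qed.

Lemma gt0_of_deviation {R : realType} {a b : \bar R} {c : R} :
  (c%:E <= b)%E -> (`|a - b| < c%:E)%E -> (0 < a)%E.
Proof.
move: a b => [a| |] [b| |] //=; rewrite ?lee_fin ?lte_fin//.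
move=> cb; rewrite ltr_norml => /andP[+ _]; rewrite ltrBrDr; apply: le_lt_trans.
by rewrite addrC subr_ge0.
Qed.

Theorem theorem4p13 (R : realType) (n : nat) (hn : (1 <= n)%N)
  (N : 'rV[R]_n -> R) (hN : is_norm N)
  (I : set R) (hI : compact I) (tm tp : R)
  (htm : I tm /\ lbound I tm) (htp : I tp /\ ubound I tp) (htmp : tm < tp)
  (phi : R -> R -> 'rV[R]_n -> 'rV[R]_n) (hphi : is_C1_process N I phi)
  (hphi0 : forall t, I t -> phi t tm 0 = 0)
  (Phi : R -> R -> 'M[R]_n)
  (hlin : forall t s, I t -> I s -> Phi t s = linearization phi tm 0 t s)
  (hPhi : LP N I tm Phi)
  (hm : mu_deviation N I tm phi Phi r
          @[r --> within [set r : R | 0 <= r] (nbhs (0 : R))] --> mu_deviation N I tm phi Phi 0)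
  (Q : 'End('rV[R]_n)) (hQ : (Q \o Q)%VF = Q)
  (himQ : sub_cone (limg Q) (stable_cone N I tm Phi))
  (hkerQ : sub_cone (lker Q) (unstable_cone N I tm Phi)) :
  (exists U V : set 'rV[R]_n,
     [/\ nbhs (0 : 'rV[R]_n) U, nbhs (0 : 'rV[R]_n) V,
         [set` limg Q] `&` U `<=` attraction_domain N I tm phi
       & [set` lker Q] `&` V `<=` repulsion_domain N I tm phi]) /\
  (forall t, I t ->
     tangent_space 0 (phi t tm @` [set` limg Q]) =
       process_of_mx Phi t tm @` [set` limg Q] /\
     tangent_space 0 (phi t tm @` [set` lker Q]) =
       process_of_mx Phi t tm @` [set` lker Q]).
Proof.
have [Itm _] := htm.
have [[phi_cont phi_lip phi_id phi_comp] phi_C1 _] := hphi.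
split; last first.
  move=> t It.
  have Phi_jac : Phi t tm = jacobian (phi t tm) 0.
    by rewrite (hlin _ _ It Itm) /linearization (phi_id _ _ Itm).
  have phiK : cancel (phi t tm) (phi tm t).
    by move=> x; rewrite (phi_comp _ _ _ _ Itm It Itm) (phi_id _ _ Itm).
  have phiVK : cancel (phi tm t) (phi t tm).
    by move=> x; rewrite (phi_comp _ _ _ _ It Itm It) (phi_id _ _ It).
  have tangentE (M : {vspace 'rV[R]_n}) : tangent_space 0 (phi t tm @` [set` M]) =
      process_of_mx Phi t tm @` [set` M].
    rewrite /process_of_mx Phi_jac.
    exact: tangent_space_diffeo_image (phi_C1 _ _ It Itm)
      ((phi_C1 _ _ Itm It).1 0) phiK phiVK (hphi0 t It).
  by split.
have [cs cs_lt0 s_rate] := stable_uniform_rate hN hI Itm hPhi himQ.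
have [cu cu_gt0 u_rate] := unstable_uniform_rate hN hI Itm hPhi hkerQ.
have ncs_gt0 : 0 < - cs by rewrite oppr_gt0.
eexists; eexists; split.
(* [U] and [V] consist of the points where the rates of [phi] and of its
   linearization differ by less than [- cs] and [cu] respectively. *)
- exact: deviation_near0 hN hm _ ncs_gt0.
- exact: deviation_near0 hN hm _ cu_gt0.
- move=> x [/= xQ dev]; have [->|x0] := eqVneq x 0; first by right.
  left; split => //; have [_ dev_max] := dev x0.
  exact: lt0_of_deviation (s_rate x xQ x0) dev_max.
- move=> x [/= xQ dev]; have [->|x0] := eqVneq x 0; first by right.
  left; split => //; have [dev_min _] := dev x0.
  exact: gt0_of_deviation (u_rate x xQ x0) dev_min.
Qed.
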